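(* Fix an integer $n\ge 2$ and a real $\varepsilon>1$. Let $\mathbf{E}=\mathbf{e}\mathbf{e}^\top$ be the $n\times n$ all-ones matrix, $\mathbf{I}$ the identity, and define $$\mathbf{A}:=\mathbf{E}+\varepsilon\mathbf{I},\quad \mathbf{B}:=((n-1)+\varepsilon)\mathbf{I}-\mathbf{E}.$$ Then $\mathbf{B}$ is strictly diagonally dominant and positive definite, and $\mathbf{A}$ is copositive. Moreover, $$\operatorname{conv}(K_1)=\operatorname{conv}(K_2)=\left[\frac{1+\varepsilon}{n-2+\varepsilon},\ \frac{n+\varepsilon}{\varepsilon-1}\right],\quad [\mu_{\min}(\mathbf{A},\mathbf{B}),\mu_{\max}(\mathbf{A},\mathbf{B})]=\left[\frac{\varepsilon}{n-1+\varepsilon},\ \frac{n+\varepsilon}{\varepsilon-1}\right].$$ Hence $K_1=K_2\subsetneq[\mu_{\min}(\mathbf{A},\mathbf{B}),\mu_{\max}(\mathbf{A},\mathbf{B})]$.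
   Context: $[n]=\{1,\dots,n\}$; $\mathbf{e}\in\mathbb{R}^n$ is the all-ones vector; $\operatorname{conv}$ is the convex hull. A matrix $\mathbf{M}=(m_{ij})$ is strictly diagonally dominant if $|m_{ii}|>\sum_{j\ne i}|m_{ij}|$ for every $i\in[n]$. A symmetric matrix $\mathbf{A}$ is copositive if $\mathbf{x}^\top\mathbf{A}\mathbf{x}\ge 0$ for all componentwise nonnegative $\mathbf{x}$. For $\mathbf{B}$ positive definite, $$\mu_{\min}(\mathbf{A},\mathbf{B}):=\min_{\mathbf{x}\ne\mathbf{0}}\frac{\mathbf{x}^\top\mathbf{A}\mathbf{x}}{\mathbf{x}^\top\mathbf{B}\mathbf{x}},\quad \mu_{\max}(\mathbf{A},\mathbf{B}):=\max_{\mathbf{x}\ne\mathbf{0}}\frac{\mathbf{x}^\top\mathbf{A}\mathbf{x}}{\mathbf{x}^\top\mathbf{B}\mathbf{x}}$$ are the smallest and largest generalized eigenvalues of $(\mathbf{A},\mathbf{B})$. For $\mathbf{M}\in\mathbb{R}^{n\times n}$ set $$r_i^+(\mathbf{M}):=\sum_{j\ne i}\max\{m_{ij},0\},\quad r_i^-(\mathbf{M}):=-\sum_{j\ne i}\min\{m_{ij},0\},$$ $$m_i^+:=m_{ii}+r_i^+(\mathbf{M}),\quad m_i^-:=m_{ii}-r_i^-(\mathbf{M}),$$ $$m_{ij}^+:=m_{ii}m_{jj}-r_i^+(\mathbf{M})r_j^+(\mathbf{M}),\quad m_{ij}^-:=m_{ii}m_{jj}-r_i^-(\mathbf{M})r_j^-(\mathbf{M}).$$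 Thus $a_i^\pm,a_{ij}^\pm$ and $b_i^\pm,b_{ij}^\pm$ denote these quantities for $\mathbf{A}=(a_{ij})$ and $\mathbf{B}=(b_{ij})$. Further, $$s_{ij}^+(\mathbf{A},\mathbf{B}):=a_{ii}b_{jj}+a_{jj}b_{ii}+r_i^+(\mathbf{A})r_j^-(\mathbf{B})+r_j^+(\mathbf{A})r_i^-(\mathbf{B}),$$ $$s_{ij}^-(\mathbf{A},\mathbf{B}):=a_{ii}b_{jj}+a_{jj}b_{ii}+r_i^-(\mathbf{A})r_j^+(\mathbf{B})+r_j^-(\mathbf{A})r_i^+(\mathbf{B}),$$ $$P^{\mathrm{up}}_{ij}(y):=b_{ij}^-y^2-s_{ij}^+(\mathbf{A},\mathbf{B})y+a_{ij}^+,\quad P^{\mathrm{low}}_{ij}(y):=b_{ij}^+y^2-s_{ij}^-(\mathbf{A},\mathbf{B})y+a_{ij}^-.$$ The sets are $$K_1:=\bigcup_{i\in[n]}\left[\min\left(\frac{a_i^-}{b_i^-},\frac{a_i^-}{b_i^+}\right),\max\left(\frac{a_i^+}{b_i^-},\frac{a_i^+}{b_i^+}\right)\right],$$ $$K_2:=\bigcup_{\substack{i,j\in[n]\\ i\ne j}}\left[\max\left\{0,\min\{y\in\mathbb{R}\mid P^{\mathrm{low}}_{ij}(y)=0\}\right\},\max\{y\in\mathbb{R}\mid P^{\mathrm{up}}_{ij}(y)=0\}\right].$$ *)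

(* Defs.v *)
From HB Require Import structures.
From mathcomp Require Export all_boot all_order all_algebra.
From mathcomp Require Export all_classical reals convex.

Set Implicit Arguments.
Unset Strict Implicit.
Unset Printing Implicit Defensive.

Import Order.TTheory GRing.Theory Num.Theory.

Local Open Scope classical_set_scope.
Local Open Scope ring_scope.

Definition convex_hull (R : realType) (X : set R) : set R :=
  smallest (@convex_set R R^o) X.

(* Attained minimum and maximum of a set of reals, as opposed to [inf] and
   [sup]; by convention 0 if there is no minimum (resp. maximum). *)
Definition set_min (R : realType) (X : set R) : R := xget 0 (X `&` lbound X).

Definition set_max (R : realType) (X : set R) : R := xget 0 (X `&` ubound X).

Section Matrices.
Variables (R : realType) (n : nat).
Implicit Types (A B M : 'M[R]_n) (x : 'cV[R]_n) (i j : 'I_n) (y : R).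

Definition strictly_diagonally_dominant M : Prop :=
  forall i, `|M i i| > \sum_(j | j != i) `|M i j|.

(* [x^T *m M *m x] is a 1 x 1 matrix. *)
Definition qform M x : R := (x^T *m M *m x) 0 0.

Definition positive_definite M : Prop :=
  M^T = M /\ forall x, x != 0 -> 0 < qform M x.

Definition copositive M : Prop :=
  M^T = M /\ forall x, (forall i, 0 <= x i 0) -> 0 <= qform M x.

Definition rayleigh_quotients A B : set R :=
  [set qform A x / qform B x | x in [set x | x != 0]].

(* Smallest and largest generalized eigenvalue of the pair (A, B), meant for
   B positive definite. *)
Definition mu_min A B : R := set_min (rayleigh_quotients A B).

Definition mu_max A B : R := set_max (rayleigh_quotients A B).

Definition rplus M i : R := \sum_(j | j != i) Num.max (M i j) 0.

Definition rminus M i : R := - \sum_(j | j != i) Num.min (M i j) 0.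

(* m_i^+, m_i^-, m_ij^+ and m_ij^- *)
Definition mplus M i : R := M i i + rplus M i.

Definition mminus M i : R := M i i - rminus M i.

Definition mplus2 M i j : R := M i i * M j j - rplus M i * rplus M j.

Definition mminus2 M i j : R := M i i * M j j - rminus M i * rminus M j.

Definition splus A B i j : R :=
  A i i * B j j + A j j * B i i + rplus A i * rminus B j + rplus A j * rminus B i.

Definition sminus A B i j : R :=
  A i i * B j j + A j j * B i i + rminus A i * rplus B j + rminus A j * rplus B i.

Definition Pup A B i j y : R :=
  mminus2 B i j * y ^+ 2 - splus A B i j * y + mplus2 A i j.

Definition Plow A B i j y : R :=
  mplus2 B i j * y ^+ 2 - sminus A B i j * y + mminus2 A i j.

Definition K1 A B : set R :=
  \bigcup_(i in [set: 'I_n])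
    `[Num.min (mminus A i / mminus B i) (mminus A i / mplus B i),
      Num.max (mplus A i / mminus B i) (mplus A i / mplus B i)]%classic.

Definition K2 A B : set R :=
  \bigcup_(p in [set p : 'I_n * 'I_n | p.1 != p.2])
    `[Num.max 0 (set_min [set y | Plow A B p.1 p.2 y = 0]),
      set_max [set y | Pup A B p.1 p.2 y = 0]]%classic.

End Matrices.

(* Main.v *)
(** All the quantities are explicit. With [d = n-2+eps] and [r = n-1], every
    index pair gives [Plow y = (d y - (1+eps))^2] and
    [Pup y = ((d-r) y - (1+eps+r)) ((d+r) y - (1+eps-r))], so [K1] and [K2] are
    unions of copies of one interval. Writing [s] for the sum of the coordinates
    of [x] and [q] for the sum of their squares, the Rayleigh quotient is
    [(s^2 + eps q) / ((n-1+eps) q - s^2)], which increases with [s^2]; since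
    [0 <= s^2 <= n q] it is minimal when the coordinates sum to 0 and maximal at
    the all-ones vector. *)

Require Import Defs.
From mathcomp Require Import interval_inference ring lra.
Import Order.TTheory GRing.Theory Num.Theory.
Local Open Scope classical_set_scope.
Local Open Scope ring_scope.

Set Implicit Arguments.
Unset Strict Implicit.
Unset Printing Implicit Defensive.

(** * Extrema and convex hulls of sets of reals *)

Section RealSets.
Variable R : realType.
Implicit Types (X : set R) (a b m : R).

Lemma set_max_eq X m : X m -> ubound X m -> set_max X = m.
Proof.
move=> Xm ubm; apply: xget_unique => // y [Xy uby].
by apply/le_anti/andP; split; [exact: ubm|exact: uby].
Qed.

Lemma set_min_eq X m : X m -> lbound X m -> set_min X = m.
Proof.
move=> Xm lbm; apply: xget_unique => // y [Xy lby].
by apply/le_anti/andP; split; [exact: lby|exact: lbm].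
Qed.

Lemma convex_hull_itv a b : convex_hull `[a, b]%classic = `[a, b]%classic.
Proof.
apply: smallest_id => x y t; rewrite !inE /= !in_itv /=.
move=> /andP[ax xb] /andP[ay yb].
have t0 : 0 <= t%:num by [].
have t1 : t%:num <= 1 by [].
(* The convex combination in [R^o] unfolds to ordinary arithmetic in [R]. *)
suff : a <= t%:num * (x : R) + (1 - t%:num) * (y : R) <= b by [].
by apply/andP; split; nra.
Qed.

End RealSets.

(** * Quadratic forms in terms of coordinate sums and sums of squares *)

Section SumsAndForms.
Variables (R : realType) (n : nat).
Implicit Types (x : 'cV[R]_n) (M : 'M[R]_n) (c d : R).

Definition coord_sum x : R := \sum_i x i 0.

Definition sq_norm x : R := \sum_i x i 0 ^+ 2.

Lemma sum_neq_const (i : 'I_n) (F : 'I_n -> R) c :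
  (forall j, j != i -> F j = c) -> \sum_(j | j != i) F j = (n%:R - 1) * c.
Proof.
move=> Fc; rewrite (eq_bigr _ Fc) sumr_const cardC1 card_ord -subn1.
by rewrite -[LHS]mulr_natl natrB // (leq_ltn_trans _ (ltn_ord i)).
Qed.

Lemma sq_norm_gt0 x : x != 0 -> 0 < sq_norm x.
Proof.
move=> x0; rewrite lt_def sumr_ge0 ?andbT; last by move=> i _; exact: sqr_ge0.
apply: contra x0 => /eqP q0; apply/eqP/matrixP => i j; rewrite ord1 mxE.
have /psumr_eq0P := q0 => /(_ (fun k _ => sqr_ge0 _)) /(_ i isT) /eqP.
by rewrite sqrf_eq0 => /eqP.
Qed.

(* Expand [0 <= \sum_i (n * x i - coord_sum x)^2]. *)
Lemma coord_sum_sq_le x : coord_sum x ^+ 2 <= n%:R * sq_norm x.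
Proof.
(* The expansion yields [n] times the claim, so [n = 0], where all sums are empty, is treated
   apart. *)
case: (posnP n) => [n0|n0].
  rewrite /coord_sum big1 ?expr0n ?mulr_ge0 ?sumr_ge0 //.
    by move=> i _; exact: sqr_ge0.
  by move=> i _; have := leq_ltn_trans (leq0n i) (ltn_ord i); rewrite [X in (_ < X)%N]n0.
have n0' : 0 < n%:R :> R by rewrite ltr0n.
rewrite -subr_ge0 -(pmulr_rge0 _ n0').
have : 0 <= \sum_i (n%:R * x i 0 - coord_sum x) ^+ 2.
  by apply: sumr_ge0 => i _; exact: sqr_ge0.
suff -> : \sum_i (n%:R * x i 0 - coord_sum x) ^+ 2 =
   n%:R * (n%:R * sq_norm x - coord_sum x ^+ 2) by [].
rewrite (eq_bigr (fun i => n%:R ^+ 2 * x i 0 ^+ 2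
    - (2 * n%:R * coord_sum x) * x i 0 + coord_sum x ^+ 2)); last first.
  by move=> i _; ring.
rewrite big_split sumrB /= -!mulr_sumr sumr_const card_ord -mulr_natl.
by rewrite -/(coord_sum x) -/(sq_norm x); ring.
Qed.

Lemma qformD M N x : qform (M + N) x = qform M x + qform N x.
Proof. by rewrite /qform mulmxDr mulmxDl mxE. Qed.

Lemma qformN M x : qform (- M) x = - qform M x.
Proof. by rewrite /qform mulmxN mulNmx mxE. Qed.

Lemma qform_scalar c x : qform (c *: 1%:M) x = c * sq_norm x.
Proof.
rewrite /qform -scalemxAr mulmx1 -scalemxAl !mxE; congr (_ * _).
by apply: eq_bigr => i _; rewrite mxE expr2.
Qed.

Lemma qform_ones x :
  qform (const_mx 1 *m (const_mx 1 : 'cV[R]_n)^T) x = coord_sum x ^+ 2.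
Proof.
(* Reassociate as [(x^T e) (e^T x)], a product of two scalars. *)
rewrite /qform mulmxA -mulmxA mxE big_ord1 expr2 !mxE; congr (_ * _).
  by apply: eq_bigr => i _; rewrite !mxE mulr1.
by apply: eq_bigr => i _; rewrite !mxE mul1r.
Qed.

Lemma tr_ones : ((const_mx 1 : 'cV[R]_n) *m (const_mx 1 : 'cV[R]_n)^T)^T =
  const_mx 1 *m (const_mx 1 : 'cV[R]_n)^T.
Proof. by rewrite trmx_mul trmxK. Qed.

Lemma onesE i j :
  ((const_mx 1 : 'cV[R]_n) *m (const_mx 1 : 'cV[R]_n)^T) i j = 1.
Proof. by rewrite mxE big_ord1 !mxE mulr1. Qed.

End SumsAndForms.

(** * The pair [(A, B)]: entries, inclusion sets and extreme eigenvalues *)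

Section Pair.
Variables (R : realType) (n : nat) (eps : R).
Hypotheses (hn : (2 <= n)%N) (heps : 1 < eps).

Let E : 'M[R]_n := const_mx 1 *m (const_mx 1 : 'cV[R]_n)^T.
Let A : 'M[R]_n := E + eps *: 1%:M.
Let B : 'M[R]_n := (n%:R - 1 + eps) *: 1%:M - E.
Let lo : R := (1 + eps) / (n%:R - 2 + eps).
Let hi : R := (n%:R + eps) / (eps - 1).

Let n_ge2 : 2 <= n%:R :> R. Proof. by rewrite (ler_nat R 2). Qed.

Let AE i j : A i j = 1 + eps * (i == j)%:R.
Proof. by rewrite mxE onesE !mxE. Qed.

Let BE i j : B i j = (n%:R - 1 + eps) * (i == j)%:R - 1.
Proof. by rewrite mxE [in X in _ + X]mxE onesE !mxE. Qed.

Let Aii i : A i i = 1 + eps.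
Proof. by rewrite AE eqxx mulr1. Qed.

Let Aij i j : j != i -> A i j = 1.
Proof. by rewrite AE eq_sym => /negbTE ->; rewrite mulr0 addr0. Qed.

Let Bii i : B i i = n%:R - 2 + eps.
Proof. by rewrite BE eqxx mulr1; ring. Qed.

Let Bij i j : j != i -> B i j = - 1.
Proof. by rewrite BE eq_sym => /negbTE ->; rewrite mulr0 add0r. Qed.

Let rplusA i : rplus A i = n%:R - 1.
Proof.
rewrite /rplus (@sum_neq_const _ _ _ _ 1) ?mulr1 // => j /Aij ->.
by rewrite maxElt ltr10.
Qed.

Let rminusA i : rminus A i = 0.
Proof.
rewrite /rminus (@sum_neq_const _ _ _ _ 0) ?mulr0 ?oppr0 // => j /Aij ->.
by rewrite minElt ltr10.
Qed.

Let rplusB i : rplus B i = 0.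
Proof.
rewrite /rplus (@sum_neq_const _ _ _ _ 0) ?mulr0 // => j /Bij ->.
by rewrite maxElt ltrN10.
Qed.

Let rminusB i : rminus B i = n%:R - 1.
Proof.
rewrite /rminus (@sum_neq_const _ _ _ _ (- 1)) ?mulrN ?mulr1 ?opprK // => j /Bij ->.
by rewrite minElt ltrN10.
Qed.

Let qformA x : qform A x = coord_sum x ^+ 2 + eps * sq_norm x.
Proof. by rewrite qformD qform_scalar qform_ones. Qed.

Let qformB x :
  qform B x = (n%:R - 1 + eps) * sq_norm x - coord_sum x ^+ 2.
Proof. by rewrite qformD qformN qform_scalar qform_ones. Qed.

(** By [coord_sum_sq_le], the form is at least [(eps - 1) * sq_norm x]. *)
Let qformB_gt0 x : x != 0 -> 0 < qform B x.
Proof.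
move=> /sq_norm_gt0 q0; rewrite qformB.
by have := coord_sum_sq_le x; have := heps; nra.
Qed.

(** In every row the diagonal entry exceeds the off-diagonal sum [n - 1] by [eps - 1]. *)
Lemma sddB : strictly_diagonally_dominant B.
Proof.
move=> i; rewrite (@sum_neq_const _ _ _ _ 1) => [|j /Bij ->]; last first.
  by rewrite normrN1.
by rewrite Bii ger0_norm; have := n_ge2; have := heps; lra.
Qed.

Lemma posdefB : positive_definite B.
Proof.
by split; [rewrite linearB linearZ /= trmx1 tr_ones|exact: qformB_gt0].
Qed.

Lemma copositiveA : copositive A.
Proof.
split=> [|x _]; first by rewrite linearD linearZ /= trmx1 tr_ones.
rewrite qformA addr_ge0 ?sqr_ge0 // mulr_ge0 //; first by have := heps; lra.
by apply: sumr_ge0 => i _; exact: sqr_ge0.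
Qed.

Lemma K1_eq : K1 A B = `[lo, hi]%classic.
Proof.
rewrite /K1 (eq_bigcupr (G := fun=> `[lo, hi]%classic)) ?bigcup_const //.
  by exists (Ordinal (ltnW hn)).
move=> i _; rewrite /mminus /mplus Aii Bii rplusA rminusA rplusB rminusB.
have -> : 1 + eps - 0 = 1 + eps by ring.
have -> : n%:R - 2 + eps - (n%:R - 1) = eps - 1 by ring.
have -> : n%:R - 2 + eps + 0 = n%:R - 2 + eps by ring.
have -> : 1 + eps + (n%:R - 1) = n%:R + eps by ring.
have := n_ge2; have := heps => e1 n2.
(* The numerators are positive, so the larger denominator gives the minimum and the smaller one the
   maximum. *)
have inv_le : (n%:R - 2 + eps)^-1 <= (eps - 1)^-1 by rewrite lef_pV2 ?posrE; lra.
by rewrite min_r ?max_l // ler_wpM2l //; lra.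
Qed.

(** Because [rminus A] and [rplus B] vanish, the discriminant is zero and [lo] is a double root. *)
Lemma Plow_root (i j : 'I_n) : set_min [set y | Plow A B i j y = 0] = lo.
Proof.
have := n_ge2; have := heps => e1 n2.
have PlowE y : Plow A B i j y = ((n%:R - 2 + eps) * y - (1 + eps)) ^+ 2.
  by rewrite /Plow /mplus2 /mminus2 /sminus !Aii !Bii !rplusB !rminusA; ring.
have d0 : n%:R - 2 + eps != 0 by rewrite gt_eqF //; lra.
apply: set_min_eq => [|y]; rewrite /= PlowE /lo.
  by rewrite mulrC divfK // subrr expr0n.
by move=> /eqP; rewrite sqrf_eq0 subr_eq0 => /eqP <-; rewrite mulrAC divff // mul1r.
Qed.

Lemma Pup_root (i j : 'I_n) : set_max [set y | Pup A B i j y = 0] = hi.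
Proof.
have := n_ge2; have := heps => e1 n2.
have PupE y : Pup A B i j y = ((eps - 1) * y - (n%:R + eps)) *
    ((2 * n%:R - 3 + eps) * y - (2 + eps - n%:R)).
  rewrite /Pup /mplus2 /mminus2 /splus !Aii !Bii !rplusA !rminusB; ring.
have d0 : eps - 1 != 0 by rewrite gt_eqF //; lra.
apply: set_max_eq => [|y]; rewrite /= PupE /hi.
  by rewrite [(eps - 1) * _]mulrC divfK // subrr mul0r.
rewrite ler_pdivlMr; last by lra.
(* The root of the second factor is below 1, since [3 n > 5], whereas [hi] is above 1. *)
by move=> /eqP; rewrite mulf_eq0 => /orP[] /eqP h; nra.
Qed.

Lemma K2_eq : K2 A B = `[lo, hi]%classic.
Proof.
rewrite /K2 (eq_bigcupr (G := fun=> `[lo, hi]%classic)) ?bigcup_const //.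
  (* The union is over a nonempty set of pairs: 0 and 1 are distinct indices as [n >= 2]. *)
  by exists (Ordinal (ltnW hn), Ordinal hn).
move=> p _; rewrite Plow_root Pup_root max_r // divr_ge0 //.
  by have := heps; lra.
by have := n_ge2; have := heps; lra.
Qed.

Lemma mu_min_eq : mu_min A B = eps / (n%:R - 1 + eps).
Proof.
have := n_ge2; have := heps => e1 n2.
have c0 : 0 < n%:R - 1 + eps by lra.
apply: set_min_eq => [|_ [x /= x0 <-]].
  pose i0 := Ordinal (ltnW hn); pose i1 := Ordinal hn.
  (* A nonzero vector orthogonal to the all-ones vector: its coordinate sum is 0. *)
  pose x : 'cV[R]_n := delta_mx i0 0 - delta_mx i1 0.
  have x0 : x != 0.
    apply/eqP => /matrixP /(_ i0 0); rewrite !mxE !eqxx /= subr0.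
    by move/eqP; rewrite oner_eq0.
  have sx : coord_sum x = 0.
    rewrite /coord_sum; under eq_bigr do rewrite !mxE !eqxx !andbT.
    have sum1 k : \sum_(i < n) (i == k)%:R = 1 :> R.
      by rewrite (bigD1 k) //= eqxx big1 ?addr0 // => i /negbTE ->.
    by rewrite sumrB !sum1 subrr.
  exists x => //; rewrite qformA qformB sx expr0n add0r subr0.
  by rewrite -mulf_div divff ?mulr1 // gt_eqF // sq_norm_gt0.
rewrite ler_pdivlMr ?qformB_gt0 // mulrAC ler_pdivrMr // qformA qformB.
(* After cross-multiplication the two sides differ by [(n - 1 + 2 eps) s^2]. *)
have := sqr_ge0 (coord_sum x).
by nra.
Qed.

Lemma mu_max_eq : mu_max A B = hi.
Proof.
have := n_ge2; have := heps => e1 n2.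
have c0 : 0 < eps - 1 by lra.
apply: set_max_eq => [|_ [x /= x0 <-]].
  pose x : 'cV[R]_n := const_mx 1.
  have x0 : x != 0.
    apply/eqP => /matrixP /(_ (Ordinal hn) 0); rewrite !mxE.
    by move/eqP; rewrite oner_eq0.
  have sx : coord_sum x = n%:R.
    rewrite /coord_sum; under eq_bigr do rewrite mxE.
    by rewrite sumr_const card_ord.
  have qx : sq_norm x = n%:R.
    rewrite /sq_norm; under eq_bigr do rewrite mxE expr1n.
    by rewrite sumr_const card_ord.
  exists x => //; rewrite qformA qformB sx qx /hi.
  field; rewrite !gt_eqF //=; nra.
rewrite ler_pdivrMr ?qformB_gt0 // mulrAC ler_pdivlMr // qformA qformB.
(* Here the difference of the two sides is [(n - 1 + 2 eps) (n q - s^2)]. *)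
have := coord_sum_sq_le x.
by nra.
Qed.

Lemma itv_proper :
  `[lo, hi]%classic `<` `[eps / (n%:R - 1 + eps), hi]%classic.
Proof.
have := n_ge2; have := heps => e1 n2.
have lt_lo : eps / (n%:R - 1 + eps) < lo.
  by rewrite ltr_pdivrMr ?[lo * _]mulrAC ?ltr_pdivlMr; lra.
have lo_hi : lo <= hi.
  by rewrite ler_pdivrMr ?[hi * _]mulrAC ?ler_pdivlMr; nra.
(* The right endpoints agree; the left endpoint of the larger interval witnesses strictness. *)
split=> [y|/(_ (eps / (n%:R - 1 + eps)))] /=; rewrite !in_itv /=.
  by move=> /andP[/(lt_le_trans lt_lo)/ltW -> ->].
rewrite lexx (le_trans (ltW lt_lo) lo_hi) => /(_ isT) /andP[].
by rewrite leNgt lt_lo.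
Qed.

End Pair.

Theorem proposition5p3 (R : realType) (n : nat) (eps : R)
    (hn : (2 <= n)%N) (heps : 1 < eps) :
  let e : 'cV[R]_n := const_mx 1 in
  let E : 'M[R]_n := e *m e^T in
  let A : 'M[R]_n := E + eps *: 1%:M in
  let B : 'M[R]_n := (n%:R - 1 + eps) *: 1%:M - E in
  [/\ strictly_diagonally_dominant B,
      positive_definite B &
      copositive A] /\
  [/\ convex_hull (K1 A B) =
        `[(1 + eps) / (n%:R - 2 + eps), (n%:R + eps) / (eps - 1)]%classic,
      convex_hull (K2 A B) =
        `[(1 + eps) / (n%:R - 2 + eps), (n%:R + eps) / (eps - 1)]%classic &
      `[mu_min A B, mu_max A B]%classic =
        `[eps / (n%:R - 1 + eps), (n%:R + eps) / (eps - 1)]%classic] /\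
  K1 A B = K2 A B /\
  K2 A B `<` `[mu_min A B, mu_max A B]%classic.
Proof.
move=> e E A B.
rewrite K1_eq // K2_eq // mu_min_eq // mu_max_eq // convex_hull_itv.
split; first by split; [exact: sddB|exact: posdefB|exact: copositiveA].
by split=> //; split=> //; exact: itv_proper.
Qed.
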